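(* Let $E$ be a Banach space and $1\le p,q\le\infty$ with $\frac1p+\frac1q=1$. The following are equivalent: (1) The identity $id_{E^*}$ of $E^*$ is $(q,1)$-summing. (2) $\mathrm{FBL}[E]$ satisfies an upper $p$-estimate. In this case, the upper $p$-estimate constant of $\mathrm{FBL}[E]$ and $\pi_{q,1}(id_{E^*})$ coincide.
   Context: Banach spaces are real. $H[E]$ is the vector lattice (pointwise operations) of positively homogeneous functions $f:E^*\to\mathbb R$, with $\|f\|_{\mathrm{FBL}[E]}=\sup\{\sum_{k=1}^n|f(x_k^* )|: n\in\mathbb N,\ x_1^*,\dots,x_n^*\in E^*,\ \sup_{x\in B_E}\sum_{k=1}^n|x_k^*(x)|\le 1\}$. For $x\in E$ let $\delta_x(x^* )=x^*(x)$. $\mathrm{FBL}[E]$ is the closure, in the space of $f\in H[E]$ with finite norm, of the sublattice generated by $\{\delta_x:x\in E\}$. An operator $T:F\to G$ is $(q,1)$-summing if there is $K>0$ such that $(\sum_{k=1}^n\|Tx_k\|^q)^{1/q}\le K\sup_{x^*\in B_{F^*}}\sum_{k=1}^n|x^*(x_k)|$ for all $x_1,\dots,x_n\in F$ (with max in place of the $q$-sum if $q=\infty$); $\pi_{q,1}(T)$ is the least such $K$. A Banach lattice $X$ satisfies an upper $p$-estimate with constant $C$ if $\|\bigvee_{k=1}^n|x_k|\|\le C(\sum_{k=1}^n\|x_k\|^p)^{1/p}$ for all $x_1,\dots,x_n\in X$ (with max on the right if $p=\infty$); the upper $p$-estimate constant is the least such $C$. (It suffices to check this for pairwise disjoint vectors.)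 *)

(* Defs.v *)
From HB Require Import structures.
From mathcomp Require Import all_boot all_order all_algebra.
From mathcomp Require Import all_classical all_reals all_analysis.

Set Implicit Arguments.
Unset Strict Implicit.
Unset Printing Implicit Defensive.

Import Order.TTheory GRing.Theory Num.Theory.
Import numFieldNormedType.Exports.

Local Open Scope classical_set_scope.
Local Open Scope ring_scope.

(** * Banach lattices *)

(* The order operations are part of the mixin because MathComp's [latticeType]
   cannot be joined with [completeNormedModType] in a new HB structure. *)
HB.mixin Record isBanachLattice (R : numFieldType) L
    & CompleteNormedModule R L := {
  vle : L -> L -> Prop;
  vjoin : L -> L -> L;
  vmeet : L -> L -> L;
  vle_refl : forall x, vle x x;
  vle_anti : forall x y, vle x y -> vle y x -> x = y;
  vle_trans : forall y x z, vle x y -> vle y z -> vle x z;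
  vjoinP : forall x y z, vle (vjoin x y) z <-> vle x z /\ vle y z;
  vmeetP : forall x y z, vle z (vmeet x y) <-> vle z x /\ vle z y;
  vle_add2r : forall z x y, vle x y -> vle (x + z) (y + z);
  vle_scale : forall (a : R) x, 0 <= a -> vle 0 x -> vle 0 (a *: x);
  vle_norm : forall x y, vle (vjoin x (- x)) (vjoin y (- y)) -> `|x| <= `|y|
}.

#[short(type="banachLatticeType")]
HB.structure Definition BanachLattice (R : numFieldType) :=
  {L of CompleteNormedModule R L & isBanachLattice R L}.

Definition vabs (R : numFieldType) (L : banachLatticeType R) (x : L) : L :=
  vjoin x (- x).

(* A sublattice of a vector lattice is understood to be a linear subspace. *)
Definition vector_sublattice (R : numFieldType) (L : banachLatticeType R)
    (S : set L) : Prop :=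
  [/\ S 0,
      forall (a : R) x y, S x -> S y -> S (a *: x + y),
      forall x y, S x -> S y -> S (vjoin x y)
    & forall x y, S x -> S y -> S (vmeet x y)].

Section banach_lattice_theory.
Variables (R : numFieldType) (L : banachLatticeType R).
Implicit Types x y z u w : L.

Lemma vjoin_ubl x y : vle x (vjoin x y).
Proof. by have /vjoinP[] := vle_refl (vjoin x y). Qed.

Lemma vjoin_ubr x y : vle y (vjoin x y).
Proof. by have /vjoinP[] := vle_refl (vjoin x y). Qed.

Lemma vmeet_lbl x y : vle (vmeet x y) x.
Proof. by have /vmeetP[] := vle_refl (vmeet x y). Qed.

Lemma vmeet_lbr x y : vle (vmeet x y) y.
Proof. by have /vmeetP[] := vle_refl (vmeet x y). Qed.

Lemma vle_add x y u w : vle x y -> vle u w -> vle (x + u) (y + w).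
Proof.
move=> xy uw; apply: (vle_trans (y + u)); first exact: vle_add2r.
by rewrite ![y + _]addrC; exact: vle_add2r.
Qed.

Lemma vabs_ge0 x : vle 0 (vabs x).
Proof.
have h : vle 0 (vabs x + vabs x).
  by rewrite -(subrr x); apply: vle_add; [exact: vjoin_ubl|exact: vjoin_ubr].
have : vle 0 (2^-1 *: (vabs x + vabs x)) by apply: vle_scale.
have e : 2^-1 + 2^-1 = 1 :> R by rewrite [RHS]splitr mul1r.
by rewrite scalerDr -scalerDl e scale1r.
Qed.

Lemma vle_subl x y z : vle x (y + z) -> vle (x - y) z.
Proof. by move=> /(vle_add2r (- y)); rewrite addrAC subrr add0r. Qed.

Lemma vle_oppC x y : vle x y -> vle (- y) (- x).
Proof.
move=> /(vle_add2r (- x - y)).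
by rewrite addrA subrr add0r addrCA subrr addr0.
Qed.

Lemma vle_norm_absl u w :
  vle u (vabs w) -> vle (- u) (vabs w) -> `|u| <= `|w|.
Proof. by move=> h1 h2; apply: vle_norm; apply/vjoinP. Qed.

Let subD_abs x y : vle x (y + vabs (x - y)).
Proof.
have := vle_add (vle_refl y) (vjoin_ubl (x - y) (- (x - y))).
by rewrite addrCA subrr addr0.
Qed.

Let vabsB x y : vabs (x - y) = vabs (y - x).
Proof.
rewrite /vabs !opprB; apply: vle_anti; apply/vjoinP; split;
  by [exact: vjoin_ubl|exact: vjoin_ubr].
Qed.

Let leD_abs z w : vle z (z + vabs w).
Proof. by have := vle_add (vle_refl z) (vabs_ge0 w); rewrite addr0. Qed.

Lemma vjoin_lip x y z : `|vjoin x z - vjoin y z| <= `|x - y|.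
Proof.
have key (a b : L) : vle (vjoin a z) (vjoin b z + vabs (a - b)).
  apply/vjoinP; split.
    apply: vle_trans (subD_abs a b) _.
    by apply: vle_add2r; exact: vjoin_ubl.
  apply: vle_trans (leD_abs z (a - b)) _.
  by apply: vle_add2r; exact: vjoin_ubr.
apply: vle_norm_absl; first by apply: vle_subl; exact: key.
by rewrite opprB vabsB; apply: vle_subl; exact: key.
Qed.

Lemma vjoinC x y : vjoin x y = vjoin y x.
Proof.
by apply: vle_anti; apply/vjoinP; split; (exact: vjoin_ubl || exact: vjoin_ubr).
Qed.

Lemma vmeetE x y : vmeet x y = - vjoin (- x) (- y).
Proof.
apply: vle_anti.
  rewrite -[X in vle X _]opprK; apply/vle_oppC/vjoinP.
  by split; apply: vle_oppC; [exact: vmeet_lbl|exact: vmeet_lbr].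
apply/vmeetP; split.
  by rewrite -[X in vle _ X](opprK x); apply: vle_oppC; exact: vjoin_ubl.
by rewrite -[X in vle _ X](opprK y); apply: vle_oppC; exact: vjoin_ubr.
Qed.

Lemma vjoin_lip2 x x' y y' :
  `|vjoin x y - vjoin x' y'| <= `|x - x'| + `|y - y'|.
Proof.
have -> : vjoin x y - vjoin x' y' =
    (vjoin x y - vjoin x' y) + (vjoin y x' - vjoin y' x').
  by rewrite (vjoinC y) (vjoinC y') addrA subrK.
apply: le_trans (ler_normD _ _) _.
by apply: lerD; exact: vjoin_lip.
Qed.

Lemma closure_normP (A : set L) x :
  closure A x <-> forall e : R, 0 < e -> exists2 y, A y & `|x - y| < e.
Proof.
split=> [clA e e0|h B /nbhs_ballP[e /= e0 eB]].
  have /clA[y [Ay]] : nbhs x (ball x e) by exact: nbhsx_ballx.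
  by rewrite -ball_normE /= => xy; exists y.
have [y Ay xy] := h _ e0; exists y; split=> //; apply: eB.
by rewrite -ball_normE.
Qed.

Lemma vector_sublattice_closure (S : set L) :
  vector_sublattice S -> vector_sublattice (closure S).
Proof.
move=> [S0 SZ SJ SM].
have cSN x : closure S x -> closure S (- x).
  move=> /closure_normP cx; apply/closure_normP => e /cx[y Sy xy].
  exists (- y); last by rewrite -opprD normrN.
  by rewrite -scaleN1r -[_ *: _]addr0; exact: SZ.
have cSJ x y : closure S x -> closure S y -> closure S (vjoin x y).
  move=> /closure_normP cx /closure_normP cy; apply/closure_normP => e e0.
  have [x' Sx' xx'] := cx _ (divr_gt0 e0 (ltr0n _ 2)).
  have [y' Sy' yy'] := cy _ (divr_gt0 e0 (ltr0n _ 2)).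
  exists (vjoin x' y'); first exact: SJ.
  by apply: le_lt_trans (vjoin_lip2 _ _ _ _) _; rewrite [e]splitr ltrD.
split.
- exact: subset_closure.
- move=> a x y /closure_normP cx /closure_normP cy.
  apply/closure_normP => e e0.
  have a0 : 0 < `|a| + 1 by rewrite ltr_wpDl.
  have [x' Sx' xx'] := cx _ (divr_gt0 (divr_gt0 e0 (ltr0n _ 2)) a0).
  have [y' Sy' yy'] := cy _ (divr_gt0 e0 (ltr0n _ 2)).
  exists (a *: x' + y'); first exact: SZ.
  rewrite opprD addrACA -scalerBr.
  apply: le_lt_trans (ler_normD _ _) _; rewrite [e]splitr ltrD//.
  rewrite normrZ; move: xx'; rewrite ltr_pdivlMr// mulrC; apply: le_lt_trans.
  by apply: ler_wpM2r => //; rewrite lerDl.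
- exact: cSJ.
- by move=> x y cx cy; rewrite vmeetE; apply: (cSN); apply: cSJ; apply: cSN.
Qed.

End banach_lattice_theory.

(** * The dual space *)

Definition unit_ball (R : numDomainType) (E : normedModType R) : set E :=
  [set x | `|x| <= 1].

Section dual_space.
Variables (R : realType) (E : normedModType R).

Definition dual_pred : {pred E -> R} :=
  [pred f : E -> R | `[< linear (f : E -> R^o) /\ continuous f >]].

Record dual_space := DualSpace {
  dual_fun :> E -> R;
  dual_funP : dual_fun \in dual_pred }.

HB.instance Definition _ := [isSub for dual_fun].
HB.instance Definition _ := [Choice of dual_space by <:].

Lemma dual_submod_closed : submod_closed dual_pred.
Proof.
split.
  apply/asboolP; split; last exact: cst_continuous.
  by move=> a x y /=; rewrite scaler0 addr0.
move=> a f g /asboolP[lf cf] /asboolP[lg cg]; apply/asboolP; split.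
  move=> b x y /=; rewrite !fctE lf lg /= /GRing.scale /=.
  by rewrite !mulrDr !mulrA [a * b]mulrC addrACA.
move=> x; apply: (@continuousD _ R^o); last exact: cg.
exact: (@continuousZr _ R^o _ f a x (cf x)).
Qed.

HB.instance Definition _ :=
  GRing.isSubmodClosed.Build _ _ dual_pred dual_submod_closed.
HB.instance Definition _ := [SubChoice_isSubLmodule of dual_space by <:].

Implicit Types f g : dual_space.

Lemma dual_linear f : linear (f : E -> R^o).
Proof. by have /asboolP[] := dual_funP f. Qed.

Lemma dual_continuous f : continuous f.
Proof. by have /asboolP[] := dual_funP f. Qed.

HB.instance Definition _ f :=
  GRing.isLinear.Build R E R^o *:%R (dual_fun f) (dual_linear f).

Definition dual_norm f : R := sup [set `|f x| | x in @unit_ball R E].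

Lemma dual_bounded f : exists2 M : R, 0 <= M & forall x, `|f x| <= M * `|x|.
Proof.
have := @dual_continuous f.
move=> /(linear_bounded_continuous (f : {linear E -> R^o})).
move=> /(linear_boundedP (f : {linear E -> R^o})) [M [Mr h]].
exists (Num.max 0 (M + 1)); first by rewrite le_max lexx.
by move=> x; apply: h; rewrite lt_max ltrDl ltr01 orbT.
Qed.

Lemma dual_ball_has_sup f : has_sup [set `|f x| | x in @unit_ball R E].
Proof.
split; first by exists `|f 0|; exists 0 => //; rewrite /unit_ball/= normr0.
have [M M0 h] := dual_bounded f.
exists M => _ [x /= x1 <-]; apply: le_trans (h x) _.
by rewrite -[leRHS]mulr1; exact: ler_wpM2l.
Qed.

Lemma dual_norm_ge0 f : 0 <= dual_norm f.
Proof.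
apply: le_trans (normr_ge0 (f 0)) _.
apply: ub_le_sup; first exact: (dual_ball_has_sup f).2.
by exists 0 => //; rewrite /unit_ball/= normr0.
Qed.

Lemma dual_norm_le f x : `|f x| <= dual_norm f * `|x|.
Proof.
have [->|x0] := eqVneq x 0; first by rewrite linear0 !normr0 mulr0.
have nx : 0 < `|x| by rewrite normr_gt0.
rewrite -ler_pdivrMr//.
apply: ub_le_sup; first exact: (dual_ball_has_sup f).2.
exists (`|x|^-1 *: x).
  by rewrite /unit_ball/= normrZ normfV normr_id mulVf ?gt_eqF.
by rewrite linearZ /= normrM normfV normr_id mulrC.
Qed.

Lemma dual_norm_lub f (M : R) :
  (forall x, `|x| <= 1 -> `|f x| <= M) -> dual_norm f <= M.
Proof.
move=> h; apply: ge_sup; first exact: (dual_ball_has_sup f).1.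
by move=> _ [x /h fx <-].
Qed.

Lemma dual_addE f g x : (f + g) x = f x + g x.
Proof. by []. Qed.

Lemma dual_scaleE (a : R) f x : (a *: f) x = a * f x.
Proof. by []. Qed.

Lemma dual_norm_ball f x : `|x| <= 1 -> `|f x| <= dual_norm f.
Proof.
move=> x1; apply: le_trans (dual_norm_le _ _) _.
by rewrite -[leRHS]mulr1; apply: ler_wpM2l => //; exact: dual_norm_ge0.
Qed.

Lemma dual_ler_normD f g : dual_norm (f + g) <= dual_norm f + dual_norm g.
Proof.
apply: dual_norm_lub => x x1; rewrite dual_addE.
by apply: le_trans (ler_normD _ _) _; apply: lerD; exact: dual_norm_ball.
Qed.

Lemma dual_normZ (a : R) f : dual_norm (a *: f) = `|a| * dual_norm f.
Proof.
apply/eqP; rewrite eq_le; apply/andP; split.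
  apply: dual_norm_lub => x x1; rewrite dual_scaleE normrM.
  by apply: ler_wpM2l => //; exact: dual_norm_ball.
have [->|a0] := eqVneq a 0; first by rewrite normr0 mul0r dual_norm_ge0.
have na : 0 < `|a| by rewrite normr_gt0.
rewrite mulrC -ler_pdivlMr//; apply: dual_norm_lub => x x1.
rewrite ler_pdivlMr// mulrC -normrM -dual_scaleE.
exact: dual_norm_ball.
Qed.

Lemma dual_norm0_eq0 f : dual_norm f = 0 -> f = 0.
Proof.
move=> f0; apply/val_inj/funext => x /=; apply/eqP; rewrite -normr_le0.
by apply: le_trans (dual_norm_le f x) _; rewrite f0 mul0r.
Qed.

HB.instance Definition _ := Lmodule_isNormed.Build R dual_space
  dual_ler_normD dual_normZ dual_norm0_eq0.

End dual_space.

(** * Finite [q]-sums and summing operators *)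

(* [(sum_k a_k^q)^(1/q)], and [max_k a_k] for [q = +oo]; it is only used for
   [1 <= q] and [a_k >= 0]. *)
Definition lqsum (R : realType) (q : \bar R) (n : nat) (a : 'I_n -> R) : R :=
  match q with
  | r%:E => (\sum_(k < n) a k `^ r) `^ r^-1
  | _ => \big[Num.max/0]_(k < n) a k
  end.

Lemma lqsum_ge0 (R : realType) (q : \bar R) (n : nat) (a : 'I_n -> R) :
  0 <= lqsum q a.
Proof. by case: q => [r| |]; rewrite /lqsum ?powR_ge0// bigmax_ge_id. Qed.

Lemma le_inf_mul (R : realType) (S : set R) (a w : R) :
  S !=set0 -> 0 <= w -> (forall K, S K -> a <= K * w) -> a <= inf S * w.
Proof.
move=> S0; rewrite le_eqVlt => /predU1P[<-|w0] h.
  by have [K /h] := S0; rewrite !mulr0.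
rewrite -ler_pdivrMr//; apply: lb_le_inf => // K /h.
by rewrite ler_pdivrMr.
Qed.

Section summing.
Variables (R : realType) (F G : normedModType R).

(* The set is nonempty and bounded by [\sum_k `|x k|], so [sup] is the genuine
   supremum (also for [n = 0], where it is [0]). *)
Definition weak_l1_norm n (x : 'I_n -> F) : R :=
  sup [set \sum_(k < n) `|f (x k)| | f in @unit_ball R (dual_space F)].

Definition q1_summing_bound (q : \bar R) (T : {linear F -> G}) (K : R) : Prop :=
  forall n (x : 'I_n -> F),
    lqsum q (fun k => `|T (x k)|) <= K * weak_l1_norm x.

Definition q1_summing (q : \bar R) (T : {linear F -> G}) : Prop :=
  exists2 K : R, 0 < K & q1_summing_bound q T K.

(* This infimum is attained, see [pi_q1_least]; it is [0] for [T = 0]. *)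
Definition pi_q1 (q : \bar R) (T : {linear F -> G}) : R :=
  inf [set K : R | 0 <= K /\ q1_summing_bound q T K].

Lemma weak_l1_norm_ge0 n (x : 'I_n -> F) : 0 <= weak_l1_norm x.
Proof.
apply: ub_le_sup; last first.
  exists 0; first by rewrite /unit_ball/= normr0.
  by rewrite big1// => k _; rewrite normr0.
exists (\sum_(k < n) `|x k|) => _ [f /= f1 <-]; apply: ler_sum => k _.
apply: le_trans (dual_norm_le f (x k)) _.
by rewrite -[leRHS]mul1r; exact: ler_wpM2r.
Qed.

Lemma pi_q1_least (q : \bar R) (T : {linear F -> G}) : q1_summing q T ->
  [/\ 0 <= pi_q1 q T, q1_summing_bound q T (pi_q1 q T)
    & forall K, 0 <= K -> q1_summing_bound q T K -> pi_q1 q T <= K].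
Proof.
move=> [K0 K0_gt0 hK0].
have S0 : [set K : R | 0 <= K /\ q1_summing_bound q T K] !=set0.
  by exists K0; split => //; exact: ltW.
split; first by apply: lb_le_inf => // K [].
  move=> n x; apply: le_inf_mul => // [|K [_ hK]]; last exact: hK.
  exact: weak_l1_norm_ge0.
by move=> K K_ge0 hK; apply: ge_inf; [exists 0 => ? []|split].
Qed.

End summing.

(** * Upper [p]-estimates *)

Section upper_estimate.
Variables (R : realType) (X : banachLatticeType R).

(* Joining with [0] changes nothing, since [vabs x] is nonnegative. *)
Definition upper_estimate_bound (p : \bar R) (C : R) : Prop :=
  forall n (x : 'I_n -> X),
    `|\big[@vjoin R X/0]_(k < n) vabs (x k)| <= C * lqsum p (fun k => `|x k|).

Definition upper_estimate (p : \bar R) : Prop :=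
  exists2 C : R, 0 <= C & upper_estimate_bound p C.

(* This infimum is attained, see [upper_estimate_constant_least]. *)
Definition upper_estimate_constant (p : \bar R) : R :=
  inf [set C : R | 0 <= C /\ upper_estimate_bound p C].

Lemma upper_estimate_constant_least (p : \bar R) : upper_estimate p ->
  [/\ 0 <= upper_estimate_constant p,
      upper_estimate_bound p (upper_estimate_constant p)
    & forall C, 0 <= C -> upper_estimate_bound p C ->
        upper_estimate_constant p <= C].
Proof.
move=> [C0 C0_ge0 hC0].
have S0 : [set C : R | 0 <= C /\ upper_estimate_bound p C] !=set0 by exists C0.
split; first by apply: lb_le_inf => // C [].
  move=> n x; apply: le_inf_mul => // [|C [_ hC]]; last exact: hC.
  exact: lqsum_ge0.
by move=> C C_ge0 hC; apply: ge_inf; [exists 0 => ? []|split].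
Qed.

End upper_estimate.

(** * The free Banach lattice *)

Section fbl.
Variables (R : realType) (E : normedModType R).
Notation dualE := (dual_space E).
Implicit Types f g : dualE -> R.

(* The case [t = 0], giving [f 0 = 0], follows from the cases [0 < t]. *)
Definition positively_homogeneous f : Prop :=
  forall (t : R) (x : dualE), 0 <= t -> f (t *: x) = t * f x.

(* As the [x k] are bounded functionals, the set is bounded and [sup] is the
   genuine supremum. *)
Definition fbl_admissible n (x : 'I_n -> dualE) : Prop :=
  sup [set \sum_(k < n) `|x k y| | y in @unit_ball R E] <= 1.

(* Extended real-valued, [+oo] included. *)
Definition fbl_norm f : \bar R :=
  ereal_sup [set s : \bar R | exists n (x : 'I_n -> dualE),
    fbl_admissible x /\ s = (\sum_(k < n) `|f (x k)|)%:E].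

Lemma fbl_norm_ge f n (x : 'I_n -> dualE) : fbl_admissible x ->
  ((\sum_(k < n) `|f (x k)|)%:E <= fbl_norm f)%E.
Proof. by move=> xa; apply: ereal_sup_ubound; exists n, x. Qed.

Lemma fbl_norm_le f (M : \bar R) :
  (forall n (x : 'I_n -> dualE), fbl_admissible x ->
     ((\sum_(k < n) `|f (x k)|)%:E <= M)%E) -> (fbl_norm f <= M)%E.
Proof. by move=> h; apply: ge_ereal_sup => _ [n [x [xa ->]]]; exact: h. Qed.

Lemma fbl_admissible0 (x : 'I_0 -> dualE) : fbl_admissible x.
Proof.
apply: ge_sup; first by exists (\sum_(k < 0) `|x k 0|), 0 => //;
  rewrite /unit_ball/= normr0.
by move=> _ [y _ <-]; rewrite big_ord0.
Qed.

Lemma fbl_norm_ge0 f : (0 <= fbl_norm f)%E.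
Proof.
have := fbl_norm_ge f (@fbl_admissible0 (fun=> 0)).
by rewrite big_ord0.
Qed.

Lemma fbl_norm_mono f g :
  (forall x, `|f x| <= `|g x|) -> (fbl_norm f <= fbl_norm g)%E.
Proof.
move=> fg; apply: fbl_norm_le => n x xa.
by apply: le_trans (fbl_norm_ge g xa); rewrite lee_fin; exact: ler_sum.
Qed.

Lemma fbl_normD f g : (fbl_norm (f + g)%R <= fbl_norm f + fbl_norm g)%E.
Proof.
apply: fbl_norm_le => n x xa.
apply: le_trans (leeD (fbl_norm_ge f xa) (fbl_norm_ge g xa)).
rewrite -EFinD lee_fin -big_split; apply: ler_sum => k _ /=.
exact: ler_normD.
Qed.

Lemma fbl_norm_scale_le (a : R) f :
  (fbl_norm (fun x => (a * f x)%R) <= `|a|%:E * fbl_norm f)%E.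
Proof.
apply: fbl_norm_le => n x xa.
rewrite (eq_bigr (fun k => `|a| * `|f (x k)|)) => [|k _]; last first.
  by rewrite normrM.
by rewrite -mulr_sumr EFinM lee_wpmul2l// ?lee_fin//; exact: fbl_norm_ge.
Qed.

Lemma fbl_admissible1 (x : dualE) :
  `|x| = 1 -> fbl_admissible (fun _ : 'I_1 => x).
Proof.
move=> x1; rewrite /fbl_admissible -x1 /Num.norm/= /dual_norm.
suff -> : [set \sum_(k < 1) `|x y| | y in @unit_ball R E] =
    [set `|x y| | y in @unit_ball R E] by [].
by congr image; apply/funext => y; rewrite big_ord1.
Qed.

Lemma fbl_norm_eval f x : positively_homogeneous f ->
  (`|f x|%:E <= `|x|%:E * fbl_norm f)%E.
Proof.
move=> hf; have [->|x0] := eqVneq x 0.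
  by rewrite -(scale0r 0) hf// mul0r scale0r !normr0 mul0e.
have nx : 0 < `|x| by rewrite normr_gt0.
have u1 : `|(`|x|^-1 *: x)| = 1.
  by rewrite normrZ normfV normr_id mulVf ?gt_eqF.
have h : (`|f x|%:E = `|x|%:E * (`|x|^-1 * `|f x|)%:E)%E.
  by rewrite -EFinM mulrA divff ?mul1r ?gt_eqF.
rewrite h lee_wpmul2l ?lee_fin//.
have := fbl_norm_ge f (fbl_admissible1 u1).
by rewrite big_ord1 hf ?invr_ge0// normrM normfV normr_id.
Qed.

(* The functions of [H[E]] of finite norm. They form a Banach lattice for
   [fbl_norm] and the pointwise operations, in which the closure defining
   [FBL] is taken; since they form a vector sublattice of [H[E]], the sublattice
   generated by the [delta y] is the same in both. *)
Definition hfun_pred : {pred dualE -> R} :=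
  [pred f : dualE -> R |
    `[< positively_homogeneous f /\ (fbl_norm f < +oo)%E >]].

Record hfun := HFun { hfun_fun :> dualE -> R; hfun_funP : hfun_fun \in hfun_pred }.

HB.instance Definition _ := [isSub for hfun_fun].
HB.instance Definition _ := [Choice of hfun by <:].

Lemma fbl_norm0 : fbl_norm 0 = 0%E.
Proof.
apply/eqP; rewrite eq_le fbl_norm_ge0 andbT; apply: fbl_norm_le => n x _.
by rewrite big1// => k _; rewrite normr0.
Qed.

Lemma hfun_submod_closed : submod_closed hfun_pred.
Proof.
split.
  by apply/asboolP; split; [move=> t x _; rewrite mulr0|rewrite fbl_norm0].
move=> a f g /asboolP[hf nf] /asboolP[hg ng]; apply/asboolP; split.
  move=> t x t0; rewrite !fctE hf// hg// /GRing.scale/=.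
  by rewrite mulrDr !mulrA [a * t]mulrC.
apply: le_lt_trans (fbl_normD _ _) _; rewrite lte_add_pinfty//.
apply: le_lt_trans (fbl_norm_scale_le _ _) _.
by rewrite -(fineK (_ : fbl_norm f \is a fin_num)) ?ge0_fin_numE ?fbl_norm_ge0// -EFinM ltry.
Qed.

HB.instance Definition _ :=
  GRing.isSubmodClosed.Build _ _ hfun_pred hfun_submod_closed.
HB.instance Definition _ := [SubChoice_isSubLmodule of hfun by <:].

Implicit Types u v w : hfun.

Lemma hfun_hom u : positively_homogeneous u.
Proof. by have /asboolP[] := hfun_funP u. Qed.

Lemma hfun_lty u : (fbl_norm u < +oo)%E.
Proof. by have /asboolP[] := hfun_funP u. Qed.

Lemma hfun_fin u : fbl_norm u \is a fin_num.
Proof. by rewrite ge0_fin_numE ?fbl_norm_ge0 ?hfun_lty. Qed.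

Lemma hfun_addE u v x : (u + v) x = u x + v x.
Proof. by []. Qed.

Lemma hfun_oppE u x : (- u) x = - u x.
Proof. by []. Qed.

Lemma hfun_scaleE (a : R) u x : (a *: u) x = a * u x.
Proof. by []. Qed.

Definition hfun_norm u : R := fine (fbl_norm u).

Lemma hfun_normE u : (hfun_norm u)%:E = fbl_norm u.
Proof. by rewrite fineK ?hfun_fin. Qed.

Lemma hfun_ler_normD u v : hfun_norm (u + v) <= hfun_norm u + hfun_norm v.
Proof. by rewrite -lee_fin EFinD !hfun_normE; exact: fbl_normD. Qed.

Lemma hfun_normZ_le (a : R) u : hfun_norm (a *: u) <= `|a| * hfun_norm u.
Proof. by rewrite -lee_fin EFinM !hfun_normE; exact: fbl_norm_scale_le. Qed.

Lemma hfun_normZ (a : R) u : hfun_norm (a *: u) = `|a| * hfun_norm u.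
Proof.
apply/eqP; rewrite eq_le hfun_normZ_le/=.
have [->|a0] := eqVneq a 0.
  by rewrite normr0 mul0r -lee_fin hfun_normE fbl_norm_ge0.
have na : 0 < `|a| by rewrite normr_gt0.
rewrite -ler_pdivlMl// -normfV; apply: le_trans (hfun_normZ_le _ _).
by rewrite scalerA mulVf// scale1r.
Qed.

Lemma hfun_norm_eval u x : `|u x| <= `|x| * hfun_norm u.
Proof.
by rewrite -lee_fin EFinM hfun_normE; apply: fbl_norm_eval; exact: hfun_hom.
Qed.

Lemma hfun_norm0_eq0 u : hfun_norm u = 0 -> u = 0.
Proof.
move=> u0; apply/val_inj/funext => x /=; apply/eqP; rewrite -normr_le0.
by apply: le_trans (hfun_norm_eval u x) _; rewrite u0 mulr0.
Qed.

HB.instance Definition _ := Lmodule_isNormed.Build R hfun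
  hfun_ler_normD hfun_normZ hfun_norm0_eq0.

Lemma hfun_norm_sum u n (x : 'I_n -> dualE) : fbl_admissible x ->
  \sum_(k < n) `|u (x k)| <= `|u|.
Proof. by move=> xa; rewrite -lee_fin hfun_normE; exact: fbl_norm_ge. Qed.

Lemma hfun_complete (F : set_system hfun) : ProperFilter F -> cauchy F -> cvg F.
Proof.
move=> FF /cauchy_ballP Fc.
have cauchy_eval (x : dualE) : cvg ((u : hfun) x @[u --> F]).
  apply: R_complete; apply: cauchy_exP => e e0.
  have x1 : 0 < `|x| + 1 by rewrite ltr_wpDl.
  have [[A B] /= [FA FB] AB] := Fc _ (divr_gt0 e0 x1).
  have [u Au] := filter_ex FA.
  exists (u x); apply: filterS FB => v Bv.
  have := AB (u, v) (conj Au Bv); rewrite /= -!ball_normE /= => h.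
  apply: le_lt_trans (hfun_norm_eval (u - v) x) _.
  move: h; rewrite ltr_pdivlMr// mulrC; apply: le_lt_trans.
  by apply: ler_wpM2r; [exact: (normr_ge0 (u - v))|rewrite lerDl].
pose g (x : dualE) : R := lim ((u : hfun) x @[u --> F]).
have gE (x : dualE) : (u : hfun) x @[u --> F] --> g x := cauchy_eval x.
have unif (e : R) : 0 < e -> \forall u \near F,
    forall n (x : 'I_n -> dualE), fbl_admissible x ->
      \sum_(k < n) `|(u : hfun) (x k) - g (x k)| <= e.
  move=> e0; have [[A B] /= [FA FB] AB] := Fc _ e0.
  apply: filterS FA => u Au n x xa.
  have cv : \sum_(k < n) `|u (x k) - (v : hfun) (x k)| @[v --> F] -->
      \sum_(k < n) `|u (x k) - g (x k)|.
    apply: (cvg_big (@add_continuous R)) => k _.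
    by apply: cvg_norm; apply: cvgB; [exact: cvg_cst|exact: gE].
  rewrite -(cvg_lim _ cv)//; apply: limr_le; first by apply/cvg_ex; eexists; exact: cv.
  apply: filterS FB => v Bv.
  apply: le_trans (hfun_norm_sum (u - v) xa) _.
  by have := AB (u, v) (conj Au Bv); rewrite /= -ball_normE /= => /ltW.
have hg : positively_homogeneous g.
  move=> t x t0; have /cvg_lim <- // := gE (t *: x).
  under eq_fun do rewrite (hfun_hom _ _ t0).
  by apply/cvg_lim => //; apply: cvgMr; exact: gE.
have ng : (fbl_norm g < +oo)%E.
  have [u hu] := filter_ex (unif 1 ltr01).
  apply: (@le_lt_trans _ _ (1 + hfun_norm u)%:E); last exact: ltry.
  apply: fbl_norm_le => n x xa; rewrite lee_fin.
  apply: le_trans (lerD (hu _ _ xa) (hfun_norm_sum u xa)).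
  rewrite -big_split; apply: ler_sum => k _ /=.
  rewrite -[X in `|X| <= _](subKr (u (x k))).
  by apply: le_trans (ler_normB _ _) _; rewrite addrC.
have gH : g \in hfun_pred by apply/asboolP.
apply/cvg_ex; exists (HFun gH); apply/cvgrPdist_le => e e0.
near=> u; rewrite distrC -lee_fin hfun_normE; apply: fbl_norm_le => n x xa.
by rewrite lee_fin; have := near (unif e e0) u; apply.
Unshelve. all: by end_near. Qed.

HB.instance Definition _ := Uniform_isComplete.Build hfun hfun_complete.

Definition hfun_le u v : Prop := forall x, u x <= v x.

Lemma hfun_norm_lty u v f : positively_homogeneous f ->
  (forall x, `|f x| <= `|u x| + `|v x|) -> f \in hfun_pred.
Proof.
move=> hf h; apply/asboolP; split=> //.
apply: (@le_lt_trans _ _ (hfun_norm u + hfun_norm v)%:E); last exact: ltry.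
rewrite EFinD !hfun_normE; apply: fbl_norm_le => n x xa.
apply: le_trans (leeD (fbl_norm_ge u xa) (fbl_norm_ge v xa)).
by rewrite -EFinD lee_fin -big_split; apply: ler_sum => k _; exact: h.
Qed.

Lemma hfun_join_subproof u v : (u \max v) \in hfun_pred.
Proof.
apply: (@hfun_norm_lty u v) => [t x t0 /=|x /=].
  by rewrite !(hfun_hom _ _ t0) maxr_pMr.
by case: (leP (u x) (v x)) => _; rewrite ?lerDl ?lerDr.
Qed.

Lemma hfun_meet_subproof u v : (u \min v) \in hfun_pred.
Proof.
apply: (@hfun_norm_lty u v) => [t x t0 /=|x /=].
  by rewrite !(hfun_hom _ _ t0) minr_pMr.
by case: (leP (u x) (v x)) => _; rewrite ?lerDl ?lerDr.
Qed.

Definition hfun_join u v := HFun (hfun_join_subproof u v).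
Definition hfun_meet u v := HFun (hfun_meet_subproof u v).

Lemma hfun_le_refl u : hfun_le u u.
Proof. by move=> x. Qed.

Lemma hfun_le_anti u v : hfun_le u v -> hfun_le v u -> u = v.
Proof.
move=> uv vu; apply/val_inj/funext => x.
by apply/eqP; rewrite eq_le uv vu.
Qed.

Lemma hfun_le_trans v u w : hfun_le u v -> hfun_le v w -> hfun_le u w.
Proof. by move=> uv vw x; exact: le_trans (uv x) (vw x). Qed.

Lemma hfun_joinP u v w :
  hfun_le (hfun_join u v) w <-> hfun_le u w /\ hfun_le v w.
Proof.
split=> [h|[uw vw] x]; last by rewrite /= ge_max uw vw.
by split=> x; have := h x; rewrite /= ge_max => /andP[].
Qed.

Lemma hfun_meetP u v w :
  hfun_le w (hfun_meet u v) <-> hfun_le w u /\ hfun_le w v.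
Proof.
split=> [h|[uw vw] x]; last by rewrite /= le_min uw vw.
by split=> x; have := h x; rewrite /= le_min => /andP[].
Qed.

Lemma hfun_le_add2r w u v : hfun_le u v -> hfun_le (u + w) (v + w).
Proof. by move=> uv x; rewrite !hfun_addE lerD2r. Qed.

Lemma hfun_le_scale (a : R) u : 0 <= a -> hfun_le 0 u -> hfun_le 0 (a *: u).
Proof. by move=> a0 u0 x; rewrite hfun_scaleE; apply: mulr_ge0 => //; exact: u0. Qed.

Lemma hfun_le_norm u v :
  hfun_le (hfun_join u (- u)) (hfun_join v (- v)) -> `|u| <= `|v|.
Proof.
move=> uv; rewrite -lee_fin !hfun_normE; apply: fbl_norm_mono => x.
by rewrite -(maxrN (u x)) -(maxrN (v x)); exact: (uv x).
Qed.

HB.instance Definition _ := isBanachLattice.Build R hfun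
  hfun_le_refl hfun_le_anti hfun_le_trans hfun_joinP hfun_meetP
  hfun_le_add2r hfun_le_scale hfun_le_norm.

Lemma eval_sum_le (y : E) n (x : 'I_n -> dualE) : fbl_admissible x ->
  \sum_(k < n) `|x k y| <= `|y|.
Proof.
move=> xa; have [->|y0] := eqVneq y 0.
  by rewrite normr0 big1// => k _; rewrite linear0 normr0.
have ny : 0 < `|y| by rewrite normr_gt0.
pose z := `|y|^-1 *: y.
have z1 : `|z| <= 1 by rewrite normrZ normfV normr_id mulVf ?gt_eqF.
have : \sum_(k < n) `|x k z| <= 1.
  apply: le_trans xa; apply: ub_le_sup; last by exists z.
  exists (\sum_(k < n) `|x k|) => _ [w w1 <-].
  by apply: ler_sum => k _; exact: dual_norm_ball.
rewrite (eq_bigr (fun k => `|y|^-1 * `|x k y|)) => [|k _]; last first.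
  by rewrite /z linearZ /= normrM normfV normr_id.
by rewrite -mulr_sumr ler_pdivrMl// mulr1.
Qed.

Lemma delta_subproof (y : E) : (fun x : dualE => x y) \in hfun_pred.
Proof.
apply/asboolP; split=> [t x _ //|].
apply: (@le_lt_trans _ _ `|y|%:E); last exact: ltry.
by apply: fbl_norm_le => n x xa; rewrite lee_fin; exact: eval_sum_le.
Qed.

Definition delta (y : E) : hfun := HFun (delta_subproof y).

Definition fbl_set : set hfun :=
  closure (smallest (@vector_sublattice R hfun) (range delta)).

Definition fbl_pred : {pred hfun} := [pred u : hfun | `[< fbl_set u >]].

Record FBL := MkFBL { fbl_val :> hfun; fbl_valP : fbl_val \in fbl_pred }.

HB.instance Definition _ := [isSub for fbl_val].
HB.instance Definition _ := [Choice of FBL by <:].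

Lemma fbl_set_sublattice : vector_sublattice fbl_set.
Proof.
apply: vector_sublattice_closure; split.
- by move=> S [[]].
- by move=> a u v Su Sv S SS; have [[_ h _ _] _] := SS; apply: h; [exact: Su|exact: Sv].
- by move=> u v Su Sv S SS; have [[_ _ h _] _] := SS; apply: h; [exact: Su|exact: Sv].
- by move=> u v Su Sv S SS; have [[_ _ _ h] _] := SS; apply: h; [exact: Su|exact: Sv].
Qed.

Lemma fbl_submod_closed : submod_closed fbl_pred.
Proof.
have [S0 SZ _ _] := fbl_set_sublattice.
split; first exact/asboolP.
by move=> a u v /asboolP Su /asboolP Sv; apply/asboolP; exact: SZ.
Qed.

HB.instance Definition _ :=
  GRing.isSubmodClosed.Build _ _ fbl_pred fbl_submod_closed.
HB.instance Definition _ := [SubChoice_isSubLmodule of FBL by <:].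

Implicit Types a b c : FBL.

Lemma FBL_ler_normD a b : `|fbl_val (a + b)| <= `|fbl_val a| + `|fbl_val b|.
Proof. exact: ler_normD. Qed.

Lemma FBL_normZ (t : R) a : `|fbl_val (t *: a)| = `|t| * `|fbl_val a|.
Proof. exact: normrZ. Qed.

Lemma FBL_norm0_eq0 a : `|fbl_val a| = 0 -> a = 0.
Proof. by move=> /normr0_eq0 a0; exact: val_inj. Qed.

HB.instance Definition _ := Lmodule_isNormed.Build R FBL
  FBL_ler_normD FBL_normZ FBL_norm0_eq0.

Lemma FBL_complete (F : set_system FBL) : ProperFilter F -> cauchy F -> cvg F.
Proof.
move=> FF /cauchy_ballP Fc.
have : cvg (fbl_val a @[a --> F]).
  apply: cauchy_cvg; apply: cauchy_exP => e e0.
  have [[A B] /= [FA FB] AB] := Fc _ e0.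
  have [a Aa] := filter_ex FA.
  exists (fbl_val a); apply: filterS FB => b Bb.
  by have := AB (a, b) (conj Aa Bb); rewrite /= -!ball_normE.
move=> /cvg_ex[u Fu].
have uS : u \in fbl_pred.
  apply/asboolP; apply: (closed_cvg _ _ _ _ Fu); first exact: closed_closure.
  by apply: nearW => a; have /asboolP := fbl_valP a.
apply/cvg_ex; exists (MkFBL uS); apply/cvgrPdist_le => e e0.
by move/cvgrPdist_le : Fu => /(_ e e0).
Qed.

HB.instance Definition _ := Uniform_isComplete.Build FBL FBL_complete.

Lemma FBL_join_subproof a b : vjoin (fbl_val a) (fbl_val b) \in fbl_pred.
Proof.
have [_ _ SJ _] := fbl_set_sublattice; apply/asboolP.
by apply: SJ; apply/asboolP; exact: fbl_valP.
Qed.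

Lemma FBL_meet_subproof a b : vmeet (fbl_val a) (fbl_val b) \in fbl_pred.
Proof.
have [_ _ _ SM] := fbl_set_sublattice; apply/asboolP.
by apply: SM; apply/asboolP; exact: fbl_valP.
Qed.

Definition FBL_le a b : Prop := vle (fbl_val a) (fbl_val b).
Definition FBL_join a b : FBL := MkFBL (FBL_join_subproof a b).
Definition FBL_meet a b : FBL := MkFBL (FBL_meet_subproof a b).

Lemma FBL_le_refl a : FBL_le a a.
Proof. exact: vle_refl. Qed.

Lemma FBL_le_anti a b : FBL_le a b -> FBL_le b a -> a = b.
Proof. by move=> ab ba; apply: val_inj; exact: vle_anti. Qed.

Lemma FBL_le_trans b a c : FBL_le a b -> FBL_le b c -> FBL_le a c.
Proof. exact: vle_trans. Qed.

Lemma FBL_joinP a b c : FBL_le (FBL_join a b) c <-> FBL_le a c /\ FBL_le b c.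
Proof. exact: vjoinP. Qed.

Lemma FBL_meetP a b c : FBL_le c (FBL_meet a b) <-> FBL_le c a /\ FBL_le c b.
Proof. exact: vmeetP. Qed.

Lemma FBL_le_add2r c a b : FBL_le a b -> FBL_le (a + c) (b + c).
Proof. exact: vle_add2r. Qed.

Lemma FBL_le_scale (t : R) a : 0 <= t -> FBL_le 0 a -> FBL_le 0 (t *: a).
Proof. exact: vle_scale. Qed.

Lemma FBL_le_norm a b :
  FBL_le (FBL_join a (- a)) (FBL_join b (- b)) -> `|a| <= `|b|.
Proof. exact: (vle_norm (fbl_val a) (fbl_val b)). Qed.

HB.instance Definition _ := isBanachLattice.Build R FBL
  FBL_le_refl FBL_le_anti FBL_le_trans FBL_joinP FBL_meetP
  FBL_le_add2r FBL_le_scale FBL_le_norm.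

End fbl.

(* Main.v *)
Require Import Defs.
From HB Require Import structures.
From mathcomp Require Import all_boot all_order all_algebra.
From mathcomp Require Import all_classical all_reals all_analysis.

Set Implicit Arguments.
Unset Strict Implicit.
Unset Printing Implicit Defensive.

Import Order.TTheory GRing.Theory Num.Theory.
Import numFieldNormedType.Exports.

Local Open Scope classical_set_scope.
Local Open Scope ring_scope.

(* Both inequalities hold with the same constants, so the two infima range over
   the same set. For x_1, ..., x_n in the dual, the supremum of
   sum_k |f(x_k)| over the bidual ball is the largest norm of a signed sum of
   the x_k, hence also the supremum over the ball of [E] alone; this
   identifies [weak_l1_norm] with the quantity in the definition of the FBL
   norm. From summing to upper estimate: evaluate the join at an admissible
   family, group its members by the index where the join is attained, and apply
   Hoelder's inequality. Conversely, test the upper estimate on multiples of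
   the [delta y] with [y] almost norming the given functionals, and conclude by
   the duality of [l_p] and [l_q]. *)

(** * Duality of finite l_p and l_q sums *)

Section lqsum_duality.
Variable R : realType.
Implicit Types (p q : \bar R) (r s : R) (n : nat).

(** Splits conjugacy in the extended reals along the case distinction in [lqsum]. *)
Lemma conjugate_cases p q : (1 <= p)%E -> (1 <= q)%E -> (p^-1 + q^-1 = 1)%E ->
  [\/ p = 1%E /\ q = +oo%E, p = +oo%E /\ q = 1%E |
      exists r s, [/\ p = r%:E, q = s%:E, 0 < r, 0 < s & r^-1 + s^-1 = 1]].
Proof.
case: p => [r| |] //; case: q => [s| |] //; rewrite ?lee_fin => hr hs.
- have r0 : 0 < r by apply: lt_le_trans hr.
  have s0 : 0 < s by apply: lt_le_trans hs.
  rewrite !inver !gt_eqF// -EFinD => -[rs].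
  by constructor 3; exists r, s.
- have r0 : 0 < r by apply: lt_le_trans hr.
  rewrite invey inver gt_eqF// adde0 => -[/(congr1 GRing.inv)].
  by rewrite invrK invr1 => ->; constructor 1.
- have s0 : 0 < s by apply: lt_le_trans hs.
  rewrite invey inver gt_eqF// add0e => -[/(congr1 GRing.inv)].
  by rewrite invrK invr1 => ->; constructor 2.
- by rewrite !invey adde0 => /eqP; rewrite eqe eq_sym oner_eq0.
Qed.

Lemma lqsum1 n (a : 'I_n -> R) : (forall k, 0 <= a k) ->
  lqsum 1%E a = \sum_(k < n) a k.
Proof.
move=> a0; rewrite /lqsum invr1 powRr1.
  by apply: eq_bigr => k _; rewrite powRr1.
by apply: sumr_ge0 => k _; exact: powR_ge0.
Qed.

Lemma lqsum_powR r n (a : 'I_n -> R) : 0 < r ->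
  lqsum r%:E a `^ r = \sum_(k < n) a k `^ r.
Proof.
move=> r0; rewrite /lqsum -powRrM mulVf ?gt_eqF// powRr1//.
by apply: sumr_ge0 => k _; exact: powR_ge0.
Qed.

Lemma lqsum_eq0 r n (a : 'I_n -> R) : 0 < r -> lqsum r%:E a = 0 ->
  forall k, a k = 0.
Proof.
move=> r0 a0 k; have := lqsum_powR a r0; rewrite a0 powR0 ?gt_eqF// => /esym.
move=> /(psumr_eq0P (fun k _ => powR_ge0 _ _)) /(_ k isT).
exact: powR_eq0_eq0.
Qed.

Lemma ler_lqsum p n (a b : 'I_n -> R) : (1 <= p)%E ->
  (forall k, 0 <= a k) -> (forall k, a k <= b k) -> lqsum p a <= lqsum p b.
Proof.
case: p => [r| |] hr a0 ab; [|by apply: le_bigmax2 => k _; exact: ab|by []].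
rewrite lee_fin in hr; have r0 : 0 < r by apply: lt_le_trans hr.
have b0 k : 0 <= b k by exact: le_trans (ab k).
apply: ge0_ler_powR; rewrite ?nnegrE ?invr_ge0 ?(ltW r0)//;
  try by apply: sumr_ge0 => k _; exact: powR_ge0.
by apply: ler_sum => k _; apply: ge0_ler_powR; rewrite ?nnegrE ?(ltW r0).
Qed.

(** After scaling [a] and [b] to unit norm, Young's inequality applies term by term; the two
    resulting sums are [r^-1] and [s^-1], which add up to 1. A vanishing norm makes all products
    zero. *)
Lemma lqsum_young r s n (a b : 'I_n -> R) : 0 < r -> 0 < s -> r^-1 + s^-1 = 1 ->
  (forall k, 0 <= a k) -> (forall k, 0 <= b k) ->
  \sum_(k < n) a k * b k <= lqsum r%:E a * lqsum s%:E b.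
Proof.
move=> r0 s0 rs a0 b0.
have factor (x y u v : R) : u != 0 -> v != 0 ->
    x * y = u * v * ((x / u) * (y / v)).
  by move=> u0 v0; rewrite mulrACA (mulrC u) (mulrC v) !divfK.
set A := lqsum _ a; set B := lqsum _ b.
have [A0|A0] := eqVneq A 0.
  by rewrite A0 mul0r big1// => k _; rewrite (lqsum_eq0 r0 A0) mul0r.
have [B0|B0] := eqVneq B 0.
  by rewrite B0 mulr0 big1// => k _; rewrite (lqsum_eq0 s0 B0) mulr0.
have Agt : 0 < A by rewrite lt_neqAle eq_sym A0 lqsum_ge0.
have Bgt : 0 < B by rewrite lt_neqAle eq_sym B0 lqsum_ge0.
have normalized t (c : 'I_n -> R) C : 0 < t -> C = lqsum t%:E c -> 0 < C ->
    (forall k, 0 <= c k) -> \sum_(k < n) (c k / C) `^ t / t = t^-1.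
  move=> t0 CE C0 c0; rewrite -mulr_suml.
  under eq_bigr do rewrite powRM ?invr_ge0 ?(ltW C0)// -powR_inv1 ?(ltW C0)//.
  rewrite -mulr_suml -lqsum_powR// -CE -powRM ?powR_ge0 ?(ltW C0)//.
  by rewrite powR_inv1 ?(ltW C0)// mulfV ?gt_eqF// powR1 mul1r.
have sumA := normalized r a A r0 erefl Agt a0.
have sumB := normalized s b B s0 erefl Bgt b0.
clearbody A B.
suff h : \sum_(k < n) (a k / A) * (b k / B) <= 1.
  have -> : \sum_(k < n) a k * b k = A * B * \sum_(k < n) (a k / A) * (b k / B).
    by rewrite mulr_sumr; apply: eq_bigr => k _; exact: factor.
  by rewrite -[leRHS]mulr1 ler_wpM2l// mulr_ge0// ltW.
rewrite -rs -sumA -sumB -big_split /=; apply: ler_sum => k _.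
by apply: conjugate_powR => //; apply: divr_ge0 => //; exact: ltW.
Qed.

Lemma lqsum_hoelder p q n (a b : 'I_n -> R) :
  (1 <= p)%E -> (1 <= q)%E -> (p^-1 + q^-1 = 1)%E ->
  (forall k, 0 <= a k) -> (forall k, 0 <= b k) ->
  \sum_(k < n) a k * b k <= lqsum p a * lqsum q b.
Proof.
move=> hp hq pq a0 b0.
have [[-> ->]|[-> ->]|[r [s [-> -> r0 s0 rs]]]] := conjugate_cases hp hq pq.
- rewrite lqsum1// mulr_suml; apply: ler_sum => k _.
  by apply: ler_wpM2l => //; exact: le_bigmax.
- rewrite lqsum1// mulr_sumr; apply: ler_sum => k _.
  by apply: ler_wpM2r => //; exact: le_bigmax.
- exact: lqsum_young.
Qed.

Lemma lqsum_le_dual p q n (b : 'I_n -> R) (M : R) :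
  (1 <= p)%E -> (1 <= q)%E -> (p^-1 + q^-1 = 1)%E ->
  0 <= M -> (forall k, 0 <= b k) ->
  (forall a : 'I_n -> R, (forall k, 0 <= a k) ->
    \sum_(k < n) a k * b k <= M * lqsum p a) ->
  lqsum q b <= M.
Proof.
move=> hp hq pq M0 b0 h.
have [[pE ->]|[pE ->]|[r [s [pE -> r0 s0 rs]]]] := conjugate_cases hp hq pq;
  rewrite {}pE in h.
(* For [q = +oo], testing with the indicator of [k] isolates [b k]. *)
- apply: bigmax_le => // k _.
  have sum1 (c : 'I_n -> R) : \sum_(j < n) (j == k)%:R * c j = c k.
    rewrite (bigD1 k)//= eqxx mul1r big1 ?addr0// => j /negPf ->.
    by rewrite mul0r.
  have := h (fun j => (j == k)%:R) (fun=> ler0n _ _).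
  rewrite sum1 lqsum1 => [|j]; last exact: ler0n.
  under [in leRHS]eq_bigr do rewrite -[_%:R]mulr1.
  by rewrite (sum1 (fun=> 1)) mulr1.
(* For [q = 1], the test vector is constantly 1. *)
- rewrite lqsum1//; under eq_bigr do rewrite -[b _]mul1r.
  apply: le_trans (h (fun=> 1) (fun=> ler01)) _.
  by rewrite -[leRHS]mulr1 ler_wpM2l//; apply: bigmax_le.
- have [->//|B0] := eqVneq (lqsum s%:E b) 0.
  have Bgt : 0 < lqsum s%:E b by rewrite lt_neqAle eq_sym B0 lqsum_ge0.
  (* the extremal [a] in Hoelder's inequality is [b ^ (s - 1)] *)
  have := h (fun k => b k `^ (s - 1)) (fun k => powR_ge0 _ _).
  have s1 : s - 1 = s / r.
    by rewrite -[r^-1](addrK s^-1) rs mulrBr mulr1 mulfV ?gt_eqF.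
  have -> : \sum_(k < n) b k `^ (s - 1) * b k = lqsum s%:E b `^ s.
    rewrite lqsum_powR//; apply: eq_bigr => k _.
    rewrite -[X in _ * X]powRr1// -powRD ?subrK//.
    by rewrite gt_eqF.
  have -> : lqsum r%:E (fun k => b k `^ (s - 1)) = lqsum s%:E b `^ (s / r).
    rewrite [RHS]powRrM (lqsum_powR b s0) /lqsum; congr (_ `^ _).
    apply: eq_bigr => k _.
    by rewrite s1 -powRrM divfK ?gt_eqF.
  rewrite -s1 => hB.
  rewrite -(ler_pM2r (powR_gt0 (s - 1) Bgt)).
  by rewrite -[X in X * _]powRr1 ?lqsum_ge0// -powRD ?subrKC ?B0 ?implybT.
Qed.

End lqsum_duality.

(** * The weak l1 norm of finite families in the dual *)

Section weak_l1.
Variables (R : realType) (E : normedModType R).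
Notation dualE := (dual_space E).
Implicit Types (n : nat) (y : E).

Lemma dual_sumE (F : normedModType R) n (x : 'I_n -> dual_space F) (y : F) :
  (\sum_(k < n) x k) y = \sum_(k < n) x k y.
Proof. exact: (big_morph (fun f : dual_space F => f y)). Qed.

Lemma dual_sum_abs (F : normedModType R) (f : dual_space F) n (x : 'I_n -> F) :
  \sum_(k < n) `|f (x k)| = f (\sum_(k < n) (-1) ^+ (f (x k) < 0)%R *: x k).
Proof.
by rewrite linear_sum; apply: eq_bigr => k _; rewrite linearZ /= normrEsign.
Qed.

Lemma sum_sign_le n (x : 'I_n -> dualE) (e : 'I_n -> bool) y :
  `|(\sum_(k < n) (-1) ^+ e k *: x k) y| <= \sum_(k < n) `|x k y|.
Proof.
rewrite dual_sumE; apply: le_trans (ler_norm_sum _ _ _) _.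
by apply: ler_sum => k _; rewrite dual_scaleE normrMsign.
Qed.

(** One sign pattern serves all [y]: among the finitely many signed sums take one of largest norm.
    For a given [y], the signs of the [x k y] form a competing pattern whose value at [y] is the
    left-hand side. *)
Lemma sign_norming n (x : 'I_n -> dualE) :
  exists e : 'I_n -> bool, forall y, `|y| <= 1 ->
    \sum_(k < n) `|x k y| <= `|\sum_(k < n) (-1) ^+ e k *: x k|.
Proof.
pose z (e : {ffun 'I_n -> bool}) := \sum_(k < n) (-1) ^+ e k *: x k.
have [e _ emax] := @arg_maxP _ _ _ [ffun=> false] predT (fun e => `|z e|) isT.
exists e => y y1; apply: le_trans (emax [ffun k => (x k y < 0)%R] isT).
apply: le_trans (dual_norm_ball _ y1); apply: le_trans (ler_norm _).
rewrite dual_sumE; apply: ler_sum => k _.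
by rewrite dual_scaleE ffunE -normrEsign.
Qed.

(** For [f] in the bidual ball, the signs of the [f (x k)] turn the sum into [f u] with [u] a signed
    sum of the [x k]; this is at most the norm of [u], which is computed on the ball of [E]. *)
Lemma weak_l1_norm_dual_le n (x : 'I_n -> dualE) (M : R) :
  (forall y, `|y| <= 1 -> \sum_(k < n) `|x k y| <= M) -> weak_l1_norm x <= M.
Proof.
move=> h; apply: ge_sup.
  exists (\sum_(k < n) `|(0 : dual_space dualE) (x k)|), 0 => //.
  by rewrite /unit_ball/= normr0.
move=> _ [f /= f1 <-]; rewrite dual_sum_abs.
apply: le_trans (ler_norm _) _; apply: le_trans (dual_norm_le _ _) _.
set u := \sum_(k < n) _; apply: (@le_trans _ _ `|u|).
  by rewrite -[leRHS]mul1r; apply: ler_wpM2r.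
apply: dual_norm_lub => y y1; apply: le_trans (h _ y1); exact: sum_sign_le.
Qed.

Lemma eval_dual_subproof y : (fun f : dualE => f y) \in @dual_pred R dualE.
Proof.
apply/asboolP; split=> // f.
apply/(@cvgrPdist_lt _ R^o _ (nbhs f) (nbhs_filter f)) => e e0.
have y1 : 0 < `|y| + 1 by rewrite ltr_wpDl.
near=> g; rewrite -[f y - g y]/((f - g) y).
apply: le_lt_trans (dual_norm_le _ _) _.
apply: (@le_lt_trans _ _ (`|f - g| * (`|y| + 1))).
  by apply: ler_wpM2l; [exact: dual_norm_ge0|rewrite lerDl].
rewrite -ltr_pdivlMr//; near: g.
by apply: cvgr_dist_lt; [exact: cvg_id|exact: divr_gt0].
Unshelve. all: by end_near. Qed.

(** The canonical embedding of [E] into its bidual. *)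
Definition eval_dual y : dual_space dualE := DualSpace (eval_dual_subproof y).

Lemma weak_l1_norm_dual_ge n (x : 'I_n -> dualE) y : `|y| <= 1 ->
  \sum_(k < n) `|x k y| <= weak_l1_norm x.
Proof.
move=> y1; apply: ub_le_sup.
  exists (\sum_(k < n) `|x k|) => _ [f /= f1 <-]; apply: ler_sum => k _.
  apply: le_trans (dual_norm_le f (x k)) _.
  by rewrite -[leRHS]mul1r; exact: ler_wpM2r.
exists (eval_dual y) => //; apply: dual_norm_lub => f f1 /=.
apply: le_trans (dual_norm_le _ _) _.
by rewrite -[leRHS]mulr1; apply: ler_pM => //; exact: dual_norm_ge0.
Qed.

End weak_l1.

(** * Estimates and evaluation in the free Banach lattice *)

Section fbl_facts.
Variables (R : realType) (E : normedModType R).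
Notation dualE := (dual_space E).
Implicit Types (n : nat) (y : E).

Lemma hfun0 (u : hfun E) : u 0 = 0.
Proof. by rewrite -(scale0r (0 : dualE)) hfun_hom// mul0r. Qed.

(** By homogeneity, scaling the family by [M^-1] makes it admissible; if [M = 0], every [x k] is
    zero. *)
Lemma hfun_sum_le (u : hfun E) n (x : 'I_n -> dualE) (M : R) : 0 <= M ->
  (forall y, `|y| <= 1 -> \sum_(k < n) `|x k y| <= M) ->
  \sum_(k < n) `|u (x k)| <= `|u| * M.
Proof.
rewrite le_eqVlt => /predU1P[<- h|M0 h].
  rewrite mulr0 big1// => k _; suff -> : x k = 0 by rewrite hfun0 normr0.
  apply/dual_norm0_eq0/le_anti; rewrite dual_norm_ge0 andbT.
  apply: dual_norm_lub => y y1; apply: le_trans (h _ y1).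
  by rewrite (bigD1 k)//= lerDl sumr_ge0.
rewrite -ler_pdivrMr// mulr_suml.
have Mx : fbl_admissible (fun k => M^-1 *: x k).
  apply: ge_sup.
    exists (\sum_(k < n) `|(M^-1 *: x k) 0|), 0 => //.
    by rewrite /unit_ball/= normr0.
  move=> _ [y y1 <-]; under eq_bigr do rewrite dual_scaleE normrM.
  by rewrite -mulr_sumr ger0_norm ?invr_ge0 ?(ltW M0)// ler_pdivrMl// mulr1 h.
apply: le_trans (hfun_norm_sum u Mx); apply: ler_sum => k _.
rewrite hfun_hom ?invr_ge0 ?(ltW M0)// normrM mulrC.
by rewrite (ger0_norm (_ : 0 <= M^-1)) ?invr_ge0 ?(ltW M0).
Qed.

Lemma hfun_norm_le (u : hfun E) (M : R) :
  (forall n (x : 'I_n -> dualE), fbl_admissible x ->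
    \sum_(k < n) `|u (x k)| <= M) -> `|u| <= M.
Proof.
move=> h; rewrite -lee_fin [X in (X <= _)%E]hfun_normE; apply: fbl_norm_le.
by move=> n x /h; rewrite lee_fin.
Qed.

Lemma fbl_admissible_ball n (x : 'I_n -> dualE) y : fbl_admissible x ->
  `|y| <= 1 -> \sum_(k < n) `|x k y| <= 1.
Proof. by move=> /eval_sum_le h y1; apply: le_trans (h y) y1. Qed.

Lemma FBL_bigjoinE n (f : 'I_n -> FBL E) (t : dualE) :
  (\big[@vjoin R (FBL E)/0]_(k < n) vabs (f k)) t =
  \big[Num.max/0]_(k < n) `|f k t|.
Proof.
rewrite (big_morph (fun u : FBL E => u t) (id1 := 0) (op1 := Num.max))//.
by apply: eq_bigr => k _; rewrite -maxrN.
Qed.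

Lemma FBL_delta_subproof y : delta y \in @fbl_pred R E.
Proof.
by apply/asboolP; apply: subset_closure => S [_ Sd]; apply: Sd; exists y.
Qed.

Definition FBL_delta y : FBL E := MkFBL (FBL_delta_subproof y).

Lemma FBL_delta_norm_le y : `|FBL_delta y| <= `|y|.
Proof. by apply: hfun_norm_le => n x; exact: eval_sum_le. Qed.

Lemma FBL_scale_deltaE (a : R) y (t : dualE) : (a *: FBL_delta y) t = a * t y.
Proof. by []. Qed.

End fbl_facts.

(** * Transfer of constants between the two properties *)

Section main.
Variables (R : realType) (E : normedModType R) (p q : \bar R).
Hypotheses (hp : (1 <= p)%E) (hq : (1 <= q)%E) (hpq : (p^-1 + q^-1 = 1)%E).
Notation dualE := (dual_space E).
Let id_dual : {linear dualE -> dualE} := idfun.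

(** Padding by 0 lets every fiber of [c] be indexed by all of ['I_m]; the padding contributes
    nothing as [g k 0 = 0]. *)
Lemma sum_fibers n m (c : 'I_m -> 'I_n) (x : 'I_m -> dualE)
    (g : 'I_n -> dualE -> R) : (forall k, g k 0 = 0) ->
  \sum_(k < n) \sum_(j < m) g k (if c j == k then x j else 0) =
  \sum_(j < m) g (c j) (x j).
Proof.
move=> g0; rewrite exchange_big; apply: eq_bigr => j _ /=.
rewrite (bigD1 (c j))//= eqxx big1 ?addr0// => k.
by rewrite eq_sym => /negPf ->.
Qed.

(* At each [x j] the join is attained at some [f (c j)]. The fiber of [c] over
   [k] is replaced by one signed sum [z k], whose norm bounds the weak l1
   norm of the fiber; the [z k] have weak l1 norm at most that of [x]. *)
Lemma q1_summing_upper_estimate (K : R) : 0 <= K ->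
  q1_summing_bound q id_dual K -> upper_estimate_bound (FBL E) p K.
Proof.
(* The empty join is 0; otherwise [ord0] is available as a starting index for [arg max]. *)
move=> K0 hK [|n] f; first by rewrite big_ord0 normr0 mulr_ge0 ?lqsum_ge0.
apply: hfun_norm_le => m x xa.
pose c j := [arg max_(k > ord0) `|f k (x j)|]%O.
pose xc k j := if c j == k then x j else 0.
have [e he] := choice (fun k => sign_norming (xc k)).
pose z k := \sum_(j < m) (-1) ^+ e k j *: xc k j.
have wz : weak_l1_norm z <= 1.
  apply: weak_l1_norm_dual_le => y y1.
  apply: le_trans (fbl_admissible_ball xa y1).
  rewrite -(sum_fibers c x (g := fun _ t => `|t y|)) => [|k]; last first.
    by rewrite normr0.
  by apply: ler_sum => k _; exact: sum_sign_le.
apply: (@le_trans _ _ (\sum_(j < m) `|f (c j) (x j)|)).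
  apply: ler_sum => j _; rewrite FBL_bigjoinE ger0_norm ?bigmax_ge_id//.
  apply: bigmax_le => // k _; rewrite /c.
  by case: arg_maxP => // k' _; exact.
rewrite -(sum_fibers c x (g := fun k t => `|f k t|)) => [|k]; last first.
  by rewrite hfun0 normr0.
apply: (@le_trans _ _ (\sum_(k < n.+1) `|f k| * `|z k|)).
  by apply: ler_sum => k _; apply: hfun_sum_le => //; exact: he.
apply: le_trans (lqsum_hoelder hp hq hpq _ _) _ => //.
rewrite mulrC; apply: ler_wpM2r; first exact: lqsum_ge0.
by apply: le_trans (hK _ z) _; rewrite -[leRHS]mulr1; exact: ler_wpM2l.
Qed.

(* The join of the [a k * |delta (y k)|] dominates [a k * |x k (y k)|] at
   [x k], and [x k (y k)] can be taken arbitrarily close to the norm of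
   [x k]. *)
Lemma upper_estimate_q1_summing (C : R) : 0 <= C ->
  upper_estimate_bound (FBL E) p C -> q1_summing_bound q id_dual C.
Proof.
move=> C0 hC n x; have w0 := weak_l1_norm_ge0 x.
apply: (lqsum_le_dual hp hq hpq) => [|k|a a0] /=; [exact: mulr_ge0|by []|].
apply/ler_addgt0Pr => e e0.
(* The error [d] is chosen so that the [a k * d] sum to at most [e]; the added 1 keeps the
   denominator positive when all [a k] vanish. *)
have s0 : 0 < \sum_(k < n) a k + 1 by rewrite ltr_wpDl// sumr_ge0.
have d0 : 0 < e / (\sum_(k < n) a k + 1) by exact: divr_gt0.
set d := e / _ in d0.
have /choice[y hy] k : exists y : E, `|y| <= 1 /\ `|x k| <= `|x k y| + d.
  have [_ [y y1 <-] h] := sup_adherent d0 (dual_ball_has_sup (x k)).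
  by exists y; split=> //; rewrite -lerBlDr ltW.
pose f k : FBL E := a k *: FBL_delta (y k).
pose J := \big[@vjoin R (FBL E)/0]_(k < n) vabs (f k).
have lef : lqsum p (fun k => `|f k|) <= lqsum p a.
  apply: ler_lqsum => // k; rewrite normrZ ger0_norm// -[leRHS]mulr1.
  by apply: ler_wpM2l => //; apply: le_trans (FBL_delta_norm_le _) (hy k).1.
have leJ : \sum_(k < n) `|J (x k)| <= C * weak_l1_norm x * lqsum p a.
  apply: le_trans (hfun_sum_le J w0 (weak_l1_norm_dual_ge x)) _.
  rewrite mulrAC; apply: ler_wpM2r => //; apply: le_trans (hC _ f) _.
  exact: ler_wpM2l.
apply: le_trans (lerD leJ (lexx e)).
apply: (@le_trans _ _ (\sum_(k < n) (a k * `|x k (y k)| + a k * d))).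
  by apply: ler_sum => k _; rewrite -mulrDr; apply: ler_wpM2l (hy k).2.
rewrite big_split; apply: lerD => /=.
  apply: ler_sum => k _; rewrite FBL_bigjoinE; apply: le_trans (ler_norm _).
  have <- : `|f k (x k)| = a k * `|x k (y k)|.
    by rewrite FBL_scale_deltaE normrM ger0_norm.
  exact: le_bigmax.
rewrite -mulr_suml /d mulrA ler_pdivrMr// mulrC.
by apply: ler_wpM2l; [exact: ltW|rewrite lerDl].
Qed.

End main.

Theorem theorem9p21 (R : realType) (E : completeNormedModType R) (p q : \bar R)
    (hp : (1 <= p)%E) (hq : (1 <= q)%E) (hpq : (p^-1 + q^-1 = 1)%E) :
  let id_dual : {linear dual_space E -> dual_space E} := idfun in
  (q1_summing q id_dual <-> upper_estimate (FBL E) p) /\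
  (q1_summing q id_dual ->
     upper_estimate_constant (FBL E) p = pi_q1 q id_dual).
Proof.
move=> id_dual.
have up K := @q1_summing_upper_estimate R E p q hp hq hpq K.
have down C := @upper_estimate_q1_summing R E p q hp hq hpq C.
split.
  split=> [[K K0 hK]|[C C0 hC]].
    by exists K; [exact: ltW|exact: up (ltW K0) hK].
  (* [C] may be 0, whereas a summing constant must be positive. *)
  exists (C + 1); first by rewrite ltr_wpDl.
  move=> n x; apply: le_trans (down C C0 hC n x) _.
  by apply: ler_wpM2r; [exact: weak_l1_norm_ge0|rewrite lerDl].
move=> _; congr inf; apply/seteqP; split=> K [K0 hK]; split=> //.
  exact: down.
exact: up.
Qed.
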